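(* For every even integer $n\geq 10$, there exists a latin square $L$ of order $n$, with rows, columns and symbols indexed by $\mathbb{Z}_n$, such that $L$ has a transversal and there are $\lfloor n/6\rfloor$ entries of $L$ that belong to every suitable diagonal of $L$.
   Context: A latin square of order $n$ indexed by $\mathbb{Z}_n$ is an $n\times n$ array with rows, columns and symbols in $\mathbb{Z}_n$ such that each symbol occurs once in each row and each column; it is viewed as the set of entries $(r,c,s)$ (symbol $s$ in row $r$, column $c$). A transversal is a set of $n$ entries containing each row, each column and each symbol exactly once. For an entry $(r,c,s)$ define $\Delta(r,c,s)$ to be the unique integer with $\Delta(r,c,s)\equiv s-r-c \pmod n$ and $-n/2<\Delta(r,c,s)\le n/2$. For even $n$, a suitable diagonal of $L$ is a set of $n$ entries of $L$, no two in the same row and no two in the same column, such that the sum of their $\Delta$-values is congruent to $n/2$ modulo $n$. *)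

(* Defs.v *)
From mathcomp Require Import all_boot all_order all_algebra.
Set Implicit Arguments. Unset Strict Implicit. Unset Printing Implicit Defensive.
Import Order.TTheory GRing.Theory Num.Theory.

(* A latin square of order n indexed by Z_n = {0,..,n-1}: L r c is the symbol
   in row r, column c.  An entry is identified with its cell (r, c); its
   symbol is L r c. *)
Definition latin_square {n : nat} (L : 'I_n -> 'I_n -> 'I_n) : Prop :=
  (forall r, injective (L r)) /\ (forall c, injective (fun r => L r c)).

Definition latin_diagonal {n : nat} (D : {set 'I_n * 'I_n}) : Prop :=
  #|D| = n /\
  {in D &, forall x y, x.1 = y.1 -> x = y} /\
  {in D &, forall x y, x.2 = y.2 -> x = y}.

Definition latin_transversal {n : nat} (L : 'I_n -> 'I_n -> 'I_n)
    (T : {set 'I_n * 'I_n}) : Prop :=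
  latin_diagonal T /\
  {in T &, forall x y, L x.1 x.2 = L y.1 y.2 -> x = y}.

Definition Delta (n r c s : nat) : int :=
  let k := ((s%:Z - r%:Z - c%:Z) %% n%:Z)%Z in
  if (2 * k <= n%:Z)%R then k else (k - n%:Z)%R.

Definition DeltaL {n : nat} (L : 'I_n -> 'I_n -> 'I_n) (x : 'I_n * 'I_n) : int :=
  Delta n x.1 x.2 (L x.1 x.2).

Definition suitable_diagonal {n : nat} (L : 'I_n -> 'I_n -> 'I_n)
    (D : {set 'I_n * 'I_n}) : Prop :=
  latin_diagonal D /\
  ((\sum_(x in D) DeltaL L x)%R = (n./2)%:Z %[mod n%:Z])%Z.

(* Main.v *)
Require Import Defs.
From mathcomp Require Import all_boot all_order all_algebra.
From mathcomp Require Import zify.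
Set Implicit Arguments. Unset Strict Implicit. Unset Printing Implicit Defensive.
Import Order.TTheory GRing.Theory Num.Theory.

(* Permute the symbols of the Cayley table of Z_n, column by column, inside
   disjoint blocks of consecutive rows.  If the entry in row r and column c is
   rho(r, c) + c, the Delta-values of a diagonal sum to the sum of
   rho(r, c) - r, so a suitable diagonal has sum(rho) = sum(r) + n/2 mod n.  The
   blocks are chosen so that the largest possible value of sum(rho) is exactly
   sum(r) + n/2 and the smallest is larger than sum(r) - n/2; then every row of a
   suitable diagonal attains its maximum.  A block of three rows contributes 3 to
   the maximum and has a row whose maximum is attained only once, which gives
   about n/6 forced entries, and pairs of rows contributing 2 adjust the total.
   Such blocks alone are symmetric (sum(r) - n/2 would also be attained), so one
   block of five rows with maximum 7 and minimum -6 breaks the symmetry.  For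
   n >= 26 a fixed arrangement of w = 26, 28 or 30 rows is extended by 6 q rows
   with one triple in every six rows, whose transversal
   cells move along arithmetic progressions.  The arrangements, and the squares
   for n < 26, come from a computer search. *)

(** * Suitable diagonals and rows that attain their maxima *)

Definition rigid (n : nat) : Prop :=
  exists L : 'I_n -> 'I_n -> 'I_n,
    latin_square L /\
    (exists T : {set 'I_n * 'I_n}, latin_transversal L T) /\
    (exists E : {set 'I_n * 'I_n},
        #|E| = n %/ 6 /\
        forall D : {set 'I_n * 'I_n}, suitable_diagonal L D -> E \subset D).

Lemma subset_of_card (T : finType) (A : {set T}) (k : nat) :
  k <= #|A| -> exists2 B : {set T}, B \subset A & #|B| = k.
Proof.
move=> leqkA; exists [set x in take k (enum A)].
  by apply/subsetP=> x; rewrite inE => /mem_take; rewrite mem_enum.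
rewrite cardsE; have /card_uniqP -> : uniq (take k (enum A)).
  by apply: take_uniq; apply: enum_uniq.
by rewrite size_takel // -cardE.
Qed.

(** By counting, the row projection of [D] is onto, so [D] has a cell in every row and is the graph
    of a function. *)
Lemma latin_diagonal_graph (n : nat) (D : {set 'I_n * 'I_n}) :
  latin_diagonal D ->
  exists2 d : 'I_n -> 'I_n, injective d & D = [set (r, d r) | r : 'I_n].
Proof.
case=> cardD [rowD colD].
have imT : [set x.1 | x in D] = setT.
  apply/eqP; rewrite eqEcard subsetT cardsT card_ord /= card_in_imset ?cardD //.
have exd r : exists c, (r, c) \in D.
  have: r \in [set x.1 | x in D] by rewrite imT inE.
  by case/imsetP=> -[r' c] rcD /= ->; exists c.
pose d r := xchoose (exd r).
have dD r : (r, d r) \in D := xchooseP (exd r).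
exists d.
  by move=> r r' drr'; have [] := colD _ _ (dD r) (dD r') drr'.
apply/esym/eqP; rewrite eqEcard; apply/andP; split.
  by apply/subsetP=> x /imsetP[r _ ->].
by rewrite cardD card_imset ?card_ord // => r r' [].
Qed.

Lemma Delta_modz (n r c s : nat) :
  (Delta n r c s = s%:Z - r%:Z - c%:Z %[mod n%:Z])%Z.
Proof.
rewrite /Delta; case: ifP => _; first by rewrite modz_mod.
by rewrite -[LHS]modzDr subrK modz_mod.
Qed.

(** The column cancels in s - r - c, so modulo n each entry contributes [rho r (d r) - r]. *)
Lemma Delta_sum (n : nat) (L : 'I_n -> 'I_n -> 'I_n) (rho : nat -> nat -> nat)
    (d : 'I_n -> 'I_n) :
  (forall r c : 'I_n, L r c = rho r c + c %[mod n]) ->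
  (\sum_(x in [set (r, d r) | r : 'I_n]) DeltaL L x
     = (\sum_(r < n) rho r (d r))%:Z - (\sum_(r < n) r)%:Z %[mod n%:Z])%Z.
Proof.
move=> LE; rewrite big_imset /=; last by move=> r r' _ _ [].
rewrite !(big_morph Posz PoszD (erefl _)) -sumrB.
apply/eqP; rewrite eqz_mod_dvd -sumrB; apply: rpred_sum => r _.
rewrite -[_ \in _]eqz_mod_dvd /DeltaL Delta_modz eqz_mod_dvd.
have /eqP: L r (d r) = rho r (d r) + d r %[mod n] := LE _ _.
rewrite -eqz_nat -!modz_nat eqz_mod_dvd; set y := (_ - _)%R; set z := (_ - _)%R.
by have -> : z = y by rewrite /z /y /=; lia.
Qed.

(* The values of [rho] along a suitable diagonal sum to [n/2 + \sum r] modulo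
   [n], and the two sum conditions leave only the sum of the maxima [U r] as a
   possible value, so a suitable diagonal attains the maximum in every row. *)
Lemma rigid_of_extremal_rows (n : nat) (rho : nat -> nat -> nat)
    (U l col : nat -> nat) (F : pred nat) :
  0 < n ->
  (forall c r r', c < n -> r < n -> r' < n ->
    rho r c = rho r' c %[mod n] -> r = r') ->
  (forall r c c', r < n -> c < n -> c' < n ->
    rho r c + c = rho r c' + c' %[mod n] -> c = c') ->
  (forall r c, r < n -> c < n -> l r <= rho r c <= U r) ->
  \sum_(r < n) U r = \sum_(r < n) r + n./2 ->
  \sum_(r < n) U r < \sum_(r < n) l r + n ->
  (forall r, r < n -> col r < n /\ rho r (col r) = U r) ->
  {in gtn n &, injective col} ->
  {in gtn n &, forall r r', U r + col r = U r' + col r' %[mod n] -> r = r'} ->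
  (forall r c, r < n -> F r -> c < n -> rho r c = U r -> c = col r \/
     exists r', [/\ r' < n, r' <> r, c = col r' &
       forall c', c' < n -> rho r' c' = U r' -> c' = col r']) ->
  n %/ 6 <= count F (iota 0 n) ->
  rigid n.
Proof.
move=> n_gt0 rho_inj row_inj bounds sumU suml colP col_inj sym_inj forced cntF.
pose L (r c : 'I_n) := Ordinal (ltn_pmod (rho r c + c) n_gt0).
have LE r c : L r c = rho r c + c %[mod n] by rewrite /= modn_mod.
pose colO (r : 'I_n) := Ordinal (colP r (ltn_ord r)).1.
have colO_inj : injective colO.
  by move=> r r' /(congr1 val) /= /col_inj e; apply/val_inj/e; rewrite inE.
exists L; split; [split|split].
- by move=> r c c' /(congr1 val) /= /row_inj e; apply/val_inj/e.
- move=> c r r' /(congr1 val) /= /eqP; rewrite eqn_modDr => /eqP /rho_inj e.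
  by apply/val_inj/e.
- exists [set (r, colO r) | r : 'I_n]; split; [split; [|split]|].
  + by rewrite card_imset ?card_ord // => r r' [].
  + by move=> _ _ /imsetP[r _ ->] /imsetP[r' _ ->] /= ->.
  + by move=> _ _ /imsetP[r _ ->] /imsetP[r' _ ->] /= /colO_inj ->.
  + move=> _ _ /imsetP[r _ ->] /imsetP[r' _ ->] /(congr1 val) /=.
    rewrite (colP r (ltn_ord r)).2 (colP r' (ltn_ord r')).2 => /sym_inj e.
    by have -> : r = r' by apply/val_inj/e; rewrite inE.
(* More than n / 6 rows may satisfy [F], so [E] is cut out of [E0] to have the exact cardinality. *)
pose E0 := [set (r, colO r) | r : 'I_n in [pred r : 'I_n | F r]].
have cardE0 : #|E0| = count F (iota 0 n).
  rewrite card_imset; last by move=> r r' [].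
  by rewrite cardE size_filter -enumT -val_enum_ord count_map; apply: eq_count.
have [E EE0 cardE] : exists2 E : {set 'I_n * 'I_n}, E \subset E0 & #|E| = n %/ 6.
  by apply: subset_of_card; rewrite cardE0.
exists E; split=> // D [/latin_diagonal_graph [d d_inj ->]].
rewrite (Delta_sum _ LE) => sumD; apply: (subset_trans EE0).
have le_rho (r : 'I_n) : l r <= rho r (d r) <= U r by apply: bounds.
have sum_rho : \sum_(r < n) rho r (d r) = \sum_(r < n) U r.
  have le1 : \sum_(r < n) rho r (d r) <= \sum_(r < n) U r.
    by apply: leq_sum => r _; case/andP: (le_rho r).
  have le2 : \sum_(r < n) l r <= \sum_(r < n) rho r (d r).
    by apply: leq_sum => r _; case/andP: (le_rho r).
  move: le1 le2 suml sumU sumD; move: (\sum_(r < n) rho r (d r)) => sR.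
  move: (\sum_(r < n) U r) (\sum_(r < n) l r) (\sum_(r < n) r) => sU sl s.
  move=> le1 le2 suml sumU /esym/eqP; rewrite eqz_mod_dvd => dvdn_sum.
  (* The multiple [sU - sR] of n lies between 0 and [sU - sl], which is below n, so it vanishes. *)
  have: (n%:Z %| (sU - sR)%N%:Z)%Z by move: dvdn_sum; congr (_ %| _)%Z; lia.
  by rewrite dvdzE /= => /dvdnP[[|q]]; rewrite ?mul0n ?mulSn; lia.
have rhoU (r : 'I_n) : rho r (d r) = U r.
  have := leqif_sum (fun (r : 'I_n) (_ : true) =>
    leqif_eq (proj2 (andP (le_rho r)))).
  case=> _; rewrite sum_rho eqxx => /esym/forallP/(_ r)/implyP/(_ isT) /eqP.
  by [].
apply/subsetP=> _ /imsetP[r Fr ->]; rewrite inE in Fr.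
suff -> : colO r = d r by apply: imset_f.
apply/val_inj => /=.
(* In the second case the row [r'] is forced into the column that [d] already gives to [r], contrary
   to injectivity. *)
have [-> //|[r' [ltr'n neq_r' dr' uniq_r']]] :=
  forced r (d r) (ltn_ord r) Fr (ltn_ord _) (rhoU r).
have := uniq_r' (d (Ordinal ltr'n)) (ltn_ord _) (rhoU (Ordinal ltr'n)).
by rewrite -dr' => /val_inj/d_inj /(congr1 val).
Qed.

(** * Certificates checked by computation *)

Definition row_max (s : seq nat) : nat := foldr maxn 0 s.
(** The fold starts from the first element, as starting from 0 would always give 0. *)
Definition row_min (s : seq nat) : nat := foldr minn (head 0 s) s.

Definition attained_only_at (s : seq nat) (c : nat) : bool :=
  all (fun c' => (nth 0 s c' == row_max s) ==> (c' == c)) (iota 0 (size s)).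

(** A decidable form of the hypotheses of [rigid_of_extremal_rows]: [t] tabulates [rho], [cols]
    lists the columns of the transversal and [F] the forced rows. *)
Definition extremal_certificate (n : nat) (t : seq (seq nat)) (cols F : seq nat) : bool :=
  let I := iota 0 n in
  [&& size t == n, all (fun s => size s == n) t,
      all (fun c => uniq [seq nth 0 s c %% n | s <- t]) I,
      all (fun s => uniq [seq (nth 0 s c + c) %% n | c <- I]) t,
      sumn [seq row_max s | s <- t] == sumn I + n./2,
      sumn [seq row_max s | s <- t] < sumn [seq row_min s | s <- t] + n,
      size cols == n, uniq cols, all (gtn n) cols,
      all (fun r => nth 0 (nth [::] t r) (nth 0 cols r) == row_max (nth [::] t r)) I,
      uniq [seq (row_max (nth [::] t r) + nth 0 cols r) %% n | r <- I],
      all (fun r => all (fun c => [|| nth 0 (nth [::] t r) c != row_max (nth [::] t r),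
          c == nth 0 cols r |
          has (fun r' => [&& r' != r, c == nth 0 cols r' &
                             attained_only_at (nth [::] t r') c]) I]) I) F &
      n %/ 6 <= count (mem F) I].

Lemma row_max_ge (s : seq nat) (i : nat) : nth 0 s i <= row_max s.
Proof. by elim: s i => [|x s IHs] [|i] //=; rewrite leq_max ?leqnn ?IHs ?orbT. Qed.

Lemma row_min_le (s : seq nat) (i : nat) : i < size s -> row_min s <= nth 0 s i.
Proof.
rewrite /row_min; move: (head 0 s) => x0.
by elim: s i => [|x s IHs] [|i] //= lti; rewrite geq_min ?leqnn ?IHs ?orbT.
Qed.

Lemma uniq_map_inj (T : eqType) (s : seq nat) (f : nat -> T) :
  uniq [seq f i | i <- s] -> {in s &, injective f}.
Proof.
move=> uf i j si sj fij; apply/eqP; rewrite -(nth_index 0 si) -(nth_index 0 sj).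
have:= nth_uniq (f 0) _ _ uf; rewrite size_map => nu.
rewrite (_ : index i s = index j s) //; apply/eqP.
by rewrite -nu ?index_mem // !(nth_map 0) ?index_mem // !nth_index // fij.
Qed.

Lemma sum_ordE (n : nat) (f : nat -> nat) :
  \sum_(r < n) f r = sumn [seq f r | r <- iota 0 n].
Proof. by rewrite sumnE big_map -(big_mkord xpredT) /index_iota subn0. Qed.

Lemma rigid_of_certificate (n : nat) (t : seq (seq nat)) (cols F : seq nat) :
  0 < n -> extremal_certificate n t cols F -> rigid n.
Proof.
move=> n_gt0 /and5P[/eqP st /allP rowsz /allP rho_inj /allP row_inj].
case/and5P=> /eqP sumU suml /eqP sc uc /and5P[/allP ltc /allP maxc us /allP Fuq cntF].
have tE : t = [seq nth [::] t r | r <- iota 0 n].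
  by rewrite -st; apply/esym/mkseq_nth.
have In r : r < n -> r \in iota 0 n by rewrite mem_iota.
have tn r : r < n -> nth [::] t r \in t by move=> ltr; apply: mem_nth; rewrite st.
have szr r : r < n -> size (nth [::] t r) = n by move/tn/rowsz/eqP.
apply: (@rigid_of_extremal_rows n (fun r => nth 0 (nth [::] t r))
  (fun r => row_max (nth [::] t r)) (fun r => row_min (nth [::] t r))
  (nth 0 cols) (mem F)) => //.
- move=> c r r' ltc' ltr ltr' e.
  have := rho_inj _ (In _ ltc'); rewrite [in uniq _]tE -map_comp.
  by move/uniq_map_inj=> /(_ _ _ (In _ ltr) (In _ ltr') e).
- move=> r c c' ltr ltc' ltc'' e.
  have := row_inj _ (tn _ ltr).
  by move/uniq_map_inj=> /(_ _ _ (In _ ltc') (In _ ltc'') e).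
- by move=> r c ltr ltc'; rewrite row_max_ge row_min_le // szr.
- have /= -> := sum_ordE n (fun r => row_max (nth [::] t r)).
  by have /= -> := sum_ordE n id; rewrite map_id (map_comp row_max) -tE.
- have /= -> := sum_ordE n (fun r => row_max (nth [::] t r)).
  have /= -> := sum_ordE n (fun r => row_min (nth [::] t r)).
  by rewrite (map_comp row_max) (map_comp row_min) -tE.
- move=> r ltr; split; last by apply/eqP/maxc/In.
  by apply: ltc; apply: mem_nth; rewrite sc.
- move=> r r' ltr ltr' /eqP; rewrite nth_uniq ?sc //; first by move/eqP.
- move=> r r' ltr ltr' e; move/uniq_map_inj: us => /(_ _ _ (In _ ltr) (In _ ltr')).
  exact.
- move=> r c ltr /= Fr ltc' maxrc.
  have /allP/(_ _ (In _ ltc')) := Fuq _ Fr.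
  rewrite maxrc eqxx /= => /orP[/eqP|/hasP[r']]; [by left|].
  rewrite mem_iota => /andP[_ ltr'] /and3P[/eqP neq /eqP cE /allP att]; right.
  exists r'; split=> // c' ltc'' maxr'; have := att c'.
  by rewrite szr // In // -maxr' eqxx -cE => /(_ isT)/eqP.
Qed.

(** * Blocks of rows *)

Inductive block_kind := Single | Triple of bool | Pair | Quintuple.

Definition block_size (k : block_kind) : nat :=
  match k with Single => 1 | Triple _ | Pair => 3 | Quintuple => 5 end.

(* The block starting at the row [R] has in its row [i] and in the column [y],
   counted from the anchor of the block, the symbol that the Cayley table of Z_n
   has in that column and in the row [R + offset n k i y].  Summed over the rows
   of a block, [top] exceeds [i] by 3 for a triple, 2 for a pair and 7 for a
   quintuple, whereas [i] exceeds [bot] by 3, 2 and 6 respectively. *)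
Definition offset (n : nat) (k : block_kind) (i y : nat) : nat :=
  match k with
  | Single => 0
  | Triple b =>
    match (if b then 2 - i else i) with
    | 0 => if odd y then 2 else 0
    | 1 => if y == 0 then 2 else if y == 1 then 0 else 1
    | _ => if y < 2 then 1 else if odd y then 0 else 2
    end
  | Pair =>
    match i with
    | 0 => if odd y then 2 else 0
    | 1 => 1
    | _ => if odd y then 0 else 2
    end
  | Quintuple =>
    match i with
    | 0 => if y == 2 then 2 else if y == 3 then 0 else 1
    | 1 => if y == 0 then 3 else if y < 3 then 0 else if y == 3 then 1
           else if odd y then 0 else 2
    | 2 => if y == 2 then 1 else if y == n - 1 then 3 else if odd y then 4 else 0
    | 3 => if (y == 0) || (y == n - 2) then 4
           else if (y == 1) || (y == n - 1) then 2 else 3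
    | _ => if y == 0 then 2 else if (y == 1) || (y == n - 2) then 3
           else if y == n - 1 then 4 else if odd y then 2 else 4
    end
  end.

Definition top (k : block_kind) (i : nat) : nat :=
  match k with
  | Single => 0
  | Triple _ => 2
  | Pair => if i == 1 then 1 else 2
  | Quintuple => if i == 0 then 2 else if i == 1 then 3 else 4
  end.

Definition bot (k : block_kind) (i : nat) : nat :=
  match k with
  | Single => 0
  | Triple _ => 0
  | Pair => if i == 1 then 1 else 0
  | Quintuple => if i < 3 then 0 else 2
  end.

Definition pattern (n : nat) (k : block_kind) : seq (seq nat) :=
  [seq [seq offset n k i y | y <- iota 0 n] | i <- iota 0 (block_size k)].

Definition block_row (n : nat) (b : nat * nat * seq (seq nat)) (dflt : seq nat)
    (r : nat) : seq nat :=
  let: (R, x, p) := b in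
  if R <= r < R + size p
  then [seq R + nth 0 (nth [::] p (r - R)) ((c + n - x) %% n) | c <- iota 0 n]
  else dflt.

(* A block [(R, x, p)] occupies the rows [R, R + size p), and [p] is read with
   columns counted from [x]; every other row is as in the Cayley table. *)
Definition table (n : nat) (bs : seq (nat * nat * seq (seq nat))) : seq (seq nat) :=
  [seq foldr (fun b s => block_row n b s r) (nseq n r) bs | r <- iota 0 n].

(** * Orders below 26 *)

(** A quintuple leaves n / 2 - 7 to be written as a sum of 2s and 3s, which is impossible for n =
    10, 12 and 16. There a block of four rows breaks the symmetry instead: its maxima exceed the row
    numbers by 5, 6 and 5 in total, and its minima fall short of them by 4. *)
Definition pattern10 : seq (seq nat) :=
  [:: [:: 1; 1; 1; 1; 1; 3; 0; 0; 1; 1];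
      [:: 3; 0; 0; 3; 0; 0; 1; 3; 0; 0];
      [:: 2; 2; 2; 2; 2; 2; 2; 2; 2; 2];
      [:: 0; 3; 3; 0; 3; 1; 3; 1; 3; 3]].

Definition pattern12 : seq (seq nat) :=
  [:: [:: 2; 0; 2; 0; 2; 0; 2; 0; 3; 0; 0; 1];
      [:: 0; 2; 0; 2; 0; 2; 0; 2; 0; 1; 3; 0];
      [:: 3; 1; 3; 1; 3; 1; 3; 1; 2; 2; 2; 2];
      [:: 1; 3; 1; 3; 1; 3; 1; 3; 1; 3; 1; 3]].

Definition pattern16 : seq (seq nat) :=
  [:: [:: 1; 1; 1; 1; 1; 1; 1; 1; 1; 1; 1; 3; 0; 0; 1; 1];
      [:: 3; 0; 0; 3; 0; 0; 3; 0; 0; 3; 0; 0; 1; 3; 0; 0];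
      [:: 2; 2; 2; 2; 2; 2; 2; 2; 2; 2; 2; 2; 2; 2; 2; 2];
      [:: 0; 3; 3; 0; 3; 3; 0; 3; 3; 0; 3; 1; 3; 1; 3; 3]].

Lemma rigid_small (n : nat) : ~~ odd n -> 10 <= n < 26 -> rigid n.
Proof.
move=> even_n bounds.
have : n \in [:: 10; 12; 14; 16; 18; 20; 22; 24] by rewrite !inE; lia.
rewrite !inE; do 7?[case/orP]; move/eqP->.
(* The excesses of the blocks add up to n / 2, in turn as 5, 6, 7, 5 + 3, 7 + 2, 7 + 3, 7 + 2 + 2
   and 7 + 2 + 3. *)
- apply: (@rigid_of_certificate _ (table 10 [:: (1, 9, pattern10)])
    [:: 7; 4; 9; 1; 5; 6; 0; 8; 2; 3] [:: 1]) => //; by vm_compute.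
- apply: (@rigid_of_certificate _ (table 12 [:: (2, 9, pattern12)])
    [:: 1; 4; 5; 7; 9; 2; 3; 11; 8; 6; 10; 0] [:: 2; 3]) => //; by vm_compute.
- apply: (@rigid_of_certificate _ (table 14 [:: (2, 9, pattern 14 Quintuple)])
    [:: 3; 6; 11; 9; 12; 7; 5; 1; 2; 0; 10; 8; 4; 13] [:: 2; 3]) => //; by vm_compute.
- apply: (@rigid_of_certificate _
    (table 16 [:: (12, 3, pattern16); (1, 8, pattern 16 (Triple false))])
    [:: 10; 5; 8; 2; 15; 4; 6; 11; 12; 13; 7; 3; 14; 0; 9; 1] [:: 2; 12]) => //;
  by vm_compute.
- apply: (@rigid_of_certificate _
    (table 18 [:: (12, 3, pattern 18 Quintuple); (1, 8, pattern 18 Pair)])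
    [:: 6; 7; 12; 10; 16; 17; 9; 2; 4; 14; 11; 15; 5; 3; 0; 1; 13; 8]
    [:: 12; 13; 15]) => //; by vm_compute.
- apply: (@rigid_of_certificate _
    (table 20 [:: (15, 8, pattern 20 Quintuple); (9, 2, pattern 20 (Triple false))])
    [:: 17; 7; 12; 19; 14; 16; 5; 3; 15; 9; 2; 18; 4; 11; 1; 10; 8; 13; 6; 0]
    [:: 10; 15; 16]) => //; by vm_compute.
- apply: (@rigid_of_certificate _
    (table 22 [:: (13, 20, pattern 22 Quintuple); (1, 14, pattern 22 Pair);
                  (7, 15, pattern 22 Pair)])
    [:: 10; 5; 4; 6; 21; 11; 15; 14; 12; 13; 2; 8; 17; 0; 20; 1; 18; 16; 9; 7; 19; 3]
    [:: 13; 14; 16]) => //; by vm_compute.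
- apply: (@rigid_of_certificate _
    (table 24 [:: (13, 20, pattern 24 Quintuple); (1, 14, pattern 24 Pair);
                  (7, 15, pattern 24 (Triple false))])
    [:: 1; 3; 12; 4; 14; 0; 13; 8; 15; 11; 23; 21; 9; 22; 20; 17; 18; 10; 5; 7; 2;
        19; 6; 16]
    [:: 8; 13; 14; 16]) => //; by vm_compute.
Qed.

(** * Permutation properties and maxima of the blocks *)

Lemma modn_eq_lt2 (n a b : nat) :
  a < n + n -> b < n + n -> a = b %[mod n] -> [\/ a = b, a = b + n | b = a + n].
Proof.
move=> lta ltb; have mod2 c : c < n + n -> c %% n = if c < n then c else c - n.
  move=> ltc; case: ltnP => [/modn_small //|lenc].
  by rewrite -{1}(subnK lenc) modnDr modn_small //; lia.
rewrite !mod2 //; case: ltnP => ?; case: ltnP => ? ?;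
  by [constructor 1; lia | constructor 2; lia | constructor 3; lia].
Qed.

Lemma offset_bounds (n i y : nat) (k : block_kind) :
  i < block_size k -> bot k i <= offset n k i y <= top k i.
Proof.
case: k => [|b||] /=; [by []|move=> _| |].
- by case: (if b then _ else _) => [|[|?]]; repeat case: ifP.
- by case: i => [|[|[|?]]] //= _; repeat case: ifP.
- by case: i => [|[|[|[|[|?]]]]] //= _; repeat case: ifP.
Qed.

Lemma top_lt (i : nat) (k : block_kind) : i < block_size k -> top k i < block_size k.
Proof. by case: k => [|b||] //= _; repeat case: ifP. Qed.

(** Each column of a block is a permutation of its rows. Evenness of n fixes the parity of the
    exceptional columns n - 2 and n - 1. *)
Lemma offset_row_inj (n y i j : nat) (k : block_kind) :
  ~~ odd n -> 8 <= n -> y < n -> i < block_size k -> j < block_size k ->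
  offset n k i y = offset n k j y -> i = j.
Proof.
move=> even_n n_ge8 lty; case: k => [|b||] /=.
- lia.
- by case: b; case: i => [|[|[|?]]] //; case: j => [|[|[|?]]] //= _ _;
    repeat (case: ifP => /= ?); lia.
- by case: i => [|[|[|?]]] //; case: j => [|[|[|?]]] //= _ _; repeat (case: ifP => /= ?); lia.
- by case: i => [|[|[|[|[|?]]]]] //; case: j => [|[|[|[|[|?]]]]] //= _ _;
    repeat (case: ifP => /= ?); lia.
Qed.

(** Outside a few exceptional columns, a row either moves all columns by one constant or moves each
    parity class by an even constant, which permutes the residues because n is even. The exceptional
    columns rearrange a few images. Offsets are at most 4, so both sums are below 2 n. *)
Lemma offset_col_inj (n y z i : nat) (k : block_kind) :
  ~~ odd n -> 8 <= n -> y < n -> z < n -> i < block_size k ->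
  y + offset n k i y = z + offset n k i z %[mod n] -> y = z.
Proof.
move=> even_n n_ge8 lty ltz lti.
have := offset_bounds n y lti; have := offset_bounds n z lti; have := top_lt lti.
have : block_size k <= 5 by case: (k).
move=> le5 ltt leoz leoy /modn_eq_lt2 e.
have {}e := e (ltac:(lia)) (ltac:(lia)).
case: k i lti le5 ltt leoz leoy e => [|b||] i /= lti _ _ _ _.
- by case; lia.
- by case: b; case: i lti => [|[|[|?]]] //= _; case; repeat (case: ifP => /= ?); lia.
- by case: i lti => [|[|[|?]]] //= _; case; repeat (case: ifP => /= ?); lia.
- by case: i lti => [|[|[|[|[|?]]]]] //= _; case; repeat (case: ifP => /= ?); lia.
Qed.

Definition forced_row (k : block_kind) (i : nat) : bool :=
  match k with
  | Triple _ => i == 1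
  | Quintuple => (i == 0) || (i == 1) || (i == 3)
  | _ => false
  end.

Lemma offset_top_uniq (n y z i : nat) (k : block_kind) :
  ~~ odd n -> 8 <= n -> y < n -> z < n -> forced_row k i -> ~~ ((i == 3)) ->
  offset n k i y = top k i -> offset n k i z = top k i -> y = z.
Proof.
move=> even_n n_ge8 lty ltz; case: k => [|b||] //=.
  by move/eqP=> -> _; case: b; repeat (case: ifP => /= ?); lia.
by case: i => [|[|[|[|?]]]] //= _ _; repeat (case: ifP => /= ?); lia.
Qed.

(** * Squares assembled from disjoint blocks *)

(** This is c - x modulo n; adding n first keeps the truncated subtraction exact. *)
Definition shifted (n x c : nat) : nat := (c + n - x) %% n.

Lemma shifted_lt (n x c : nat) : 0 < n -> shifted n x c < n.
Proof. exact: ltn_pmod. Qed.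

Lemma shiftedK (n x c : nat) : x < n -> shifted n x c + x = c %[mod n].
Proof. by move=> ltx; rewrite modnDml subnK ?modnDr //; lia. Qed.

Lemma shifted_inj (n x c d : nat) :
  x < n -> c < n -> d < n -> shifted n x c = shifted n x d -> c = d.
Proof.
move=> ltx ltc ltd e; rewrite -(modn_small ltc) -(modn_small ltd).
by rewrite -(shiftedK c ltx) -(shiftedK d ltx) e.
Qed.

Lemma shifted_eq (n x c y : nat) :
  x < n -> c < n -> y < n -> y + x = c \/ y + x = c + n -> shifted n x c = y.
Proof.
move=> ltx ltc lty e; rewrite /shifted.
have [->|->] : c + n - x = y + n \/ c + n - x = y by lia.
  by rewrite modnDr modn_small.
by rewrite modn_small.
Qed.

(* [R r], [k r] and [x r] are the first row, the kind and the anchor column of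
   the block containing the row [r]. *)
Definition layout (n : nat) (R : nat -> nat) (k : nat -> block_kind) (x : nat -> nat) : Prop :=
  [/\ forall r, r < n -> [/\ R r <= r, r < R r + block_size (k r),
                             R r + block_size (k r) <= n & x r < n],
      forall r s, r < n -> s < n -> R r = R s -> k r = k s /\ x r = x s &
      forall r s, r < n -> s < n -> R r < R s -> R r + block_size (k r) <= R s].

Definition layout_entry (n : nat) (R : nat -> nat) (k : nat -> block_kind)
    (x : nat -> nat) (r c : nat) : nat :=
  R r + offset n (k r) (r - R r) (shifted n (x r) c).

(** In a given column, distinct blocks take values in disjoint intervals, and inside a block
    [offset_row_inj] applies; in a row, [offset_col_inj] is translated by the anchor. The constant
    shift [h] preserves distinctness of symbols and allows [sym] to be listed conveniently. *)
Lemma rigid_of_layout (n h : nat) R k x (col sym : nat -> nat) :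
  ~~ odd n -> 8 <= n -> layout n R k x ->
  (forall r, r < n -> [/\ col r < n, sym r < n,
     offset n (k r) (r - R r) (shifted n (x r) (col r)) = top (k r) (r - R r) &
     R r + top (k r) (r - R r) + col r + h = sym r %[mod n]]) ->
  {in gtn n &, injective col} -> {in gtn n &, injective sym} ->
  \sum_(r < n) (R r + top (k r) (r - R r)) = \sum_(r < n) r + n./2 ->
  \sum_(r < n) (R r + top (k r) (r - R r))
    < \sum_(r < n) (R r + bot (k r) (r - R r)) + n ->
  n %/ 6 <= count (fun r => forced_row (k r) (r - R r)) (iota 0 n) ->
  rigid n.
Proof.
move=> even_n n_ge8 [blk same apart] colP col_inj sym_inj sumU suml cntF.
have n_gt0 : 0 < n by lia.
have ltS r : r < n -> r - R r < block_size (k r) by move/blk=> []; lia.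
pose y r c := shifted n (x r) c.
have lty r c : y r c < n by apply: shifted_lt.
have y_inj r c d : r < n -> c < n -> d < n -> y r c = y r d -> c = d.
  by move=> /blk[_ _ _ ltx]; apply: shifted_inj.
have boundS r c : r < n -> R r <= layout_entry n R k x r c < R r + block_size (k r).
  move=> ltr; have := offset_bounds n (y r c) (ltS _ ltr).
  by have := top_lt (ltS _ ltr); rewrite /layout_entry /y; lia.
apply: (@rigid_of_extremal_rows n (layout_entry n R k x)
  (fun r => R r + top (k r) (r - R r)) (fun r => R r + bot (k r) (r - R r))
  col (fun r => forced_row (k r) (r - R r))) => //.
- move=> c r s ltc ltr lts.
  have [le1 lt1 le2 _] := blk _ ltr; have [le3 lt3 le4 _] := blk _ lts.
  have := boundS r c ltr; have := boundS s c lts => bs br.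
  rewrite !modn_small; [|by lia..].
  case: (ltngtP (R r) (R s)) => [lt|lt|eqR].
  + by have := apart _ _ ltr lts lt; lia.
  + by have := apart _ _ lts ltr lt; lia.
  + have [eqk eqx] := same _ _ ltr lts eqR.
    rewrite /layout_entry -eqk -eqx -eqR => /addnI.
    move/(offset_row_inj even_n n_ge8 (lty r c)) => e.
    have := ltS _ ltr; have := ltS _ lts; rewrite -eqk -eqR => l1 l2.
    by have := e l2 l1; lia.
- move=> r c d ltr ltc ltd; have [_ _ _ ltx] := blk _ ltr.
  rewrite /layout_entry -modnDmr -(shiftedK c ltx) modnDmr.
  rewrite -[RHS]modnDmr -(shiftedK d ltx) modnDmr -/(y r c) -/(y r d) => e.
  apply: (y_inj r) => //.
  apply: (offset_col_inj even_n n_ge8 (lty r c) (lty r d) (ltS _ ltr)).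
  apply/eqP; rewrite -(eqn_modDr (R r + x r)); apply/eqP.
  by move: e; congr (_ = _ %[mod _]); rewrite /y; lia.
- move=> r c ltr ltc; have := offset_bounds n (y r c) (ltS _ ltr).
  by rewrite /layout_entry -/(y r c); lia.
- by move=> r ltr; have [ltc _ e _] := colP _ ltr; rewrite /layout_entry e.
- move=> r s ltr lts e; apply: sym_inj => //.
  have [_ ltsym _ er] := colP _ ltr; have [_ ltsym' _ es] := colP _ lts.
  rewrite -(modn_small ltsym) -(modn_small ltsym') -er -es.
  by apply/eqP; rewrite eqn_modDr e.
- have uniq_col s : s < n -> forced_row (k s) (s - R s) -> s - R s != 3 ->
      forall c, c < n -> layout_entry n R k x s c = R s + top (k s) (s - R s) -> c = col s.
    move=> lts Fs neq3 c ltc /addnI e; have [ltcol _ ecol _] := colP _ lts.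
    apply: (y_inj s) => //.
    exact: (offset_top_uniq even_n n_ge8 (lty s c) (lty s (col s)) Fs neq3 e ecol).
  (* The row 3 of a quintuple attains its maximum in two columns, one of which is
     the only column where the row 1 attains its maximum. *)
  move=> r c ltr Fr ltc e.
  have [eq3|neq3] := eqVneq (r - R r) 3; last by left; apply: uniq_col.
  have kr : k r = Quintuple by move: Fr; rewrite eq3; case: (k r).
  have [le1 lt1 le2 ltx] := blk _ ltr; rewrite kr /= in lt1 le2.
  pose s := R r + 1; have lts : s < n by rewrite /s; lia.
  have [le3 lt3 le4 _] := blk _ lts.
  have eqR : R s = R r.
    case: (ltngtP (R s) (R r)) => // lt.
    + by have := apart _ _ lts ltr lt; rewrite /s in lt3 *; lia.
    + by have := apart _ _ ltr lts lt; rewrite kr /= /s in le3 *; lia.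
  have [ks xs] := same _ _ lts ltr eqR.
  have is1 : s - R s = 1 by rewrite eqR /s; lia.
  have ys : y s (col s) = 0.
    have [_ _ + _] := colP _ lts.
    by rewrite ks kr is1 /= -/(y s (col s)); repeat (case: ifP => /= ?); lia.
  have yr d : layout_entry n R k x r d = R r + top (k r) (r - R r) ->
      y r d = 0 \/ y r d = n - 2.
    rewrite /layout_entry -/(y r d) => /addnI.
    by rewrite kr eq3 /=; repeat (case: ifP => /= ?); lia.
  have ysr d : y s d = y r d by rewrite /y xs.
  have [ltcr _ ecr _] := colP _ ltr; have [ltcs _ _ _] := colP _ lts.
  have [y0|yc] := yr _ e.
    right; exists s; split=> //.
    + by rewrite /s; lia.
    + by apply: (y_inj s) => //; rewrite ys ysr.
    + by move=> d ltd; apply: uniq_col => //; rewrite is1 // ks kr.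
  (* Position 0 belongs to [col s], so [col r] must be at n - 2, like [c]. *)
  left; apply: (y_inj r) => //.
  have [y0|-> //] : y r (col r) = 0 \/ y r (col r) = n - 2.
    by apply: yr; rewrite /layout_entry ecr.
  suff : r = s by rewrite /s; lia.
  by apply: col_inj => //; apply: (y_inj s) => //; rewrite ys ysr.
Qed.

(** * Finite data for the non-periodic rows *)

(* Data for the last [2 * radius] rows: the blocks as pairs (first row, kind), and
   for each row the cell of the transversal.  The periodic part leaves two
   intervals of columns free, of sizes [radius + 1] and [radius - 1]; the pair
   [(g, c)] is the column number [c] of the first ([g = false]) or second interval. *)
Record remainder := Remainder {
  radius : nat;
  blocks : seq (nat * block_kind);
  cells : seq (bool * nat) }.

Definition cell (d : remainder) (a : nat) : bool * nat := nth (false, 0) (cells d) a.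

(** A row outside the listed blocks is a block of its own, to which [kind_of] gives the default kind
    [Single]. *)
Definition start_of (d : remainder) (a : nat) : nat :=
  foldr (fun b s => if b.1 <= a < b.1 + block_size b.2 then b.1 else s) a (blocks d).

Definition kind_of (d : remainder) (s : nat) : block_kind :=
  foldr (fun b k => if b.1 == s then b.2 else k) Single (blocks d).

Definition top_of (d : remainder) (a : nat) : nat :=
  start_of d a + top (kind_of d (start_of d a)) (a - start_of d a).

Definition bot_of (d : remainder) (a : nat) : nat :=
  start_of d a + bot (kind_of d (start_of d a)) (a - start_of d a).

Definition gap_size (d : remainder) (g : bool) : nat :=
  if g then radius d - 1 else radius d + 1.

(** Boolean counterpart of [fits]. Compared cells must share a gap, so that the differences of their
    columns do not depend on the number q of periods. *)
Definition block_fits (d : remainder) (s : nat) : bool :=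
  let col i := (cell d (s + i)).2 in
  let same i j := (cell d (s + i)).1 == (cell d (s + j)).1 in
  match kind_of d s with
  | Single => true
  | Triple _ | Pair => same 0 2 && odd (col 0 + col 2)
  | Quintuple =>
    [&& same 0 1, same 2 1, same 3 1, same 4 1, col 0 == col 1 + 2, col 3 + 2 == col 1,
        odd (col 2 + col 1), col 2 + 1 != col 1 &
        (col 4 + 1 == col 1)
          || [&& ~~ odd (col 4 + col 1), col 4 != col 1 & col 4 + 2 != col 1]]
  end.

(** Conditions at q = 0 that persist for every q: a period adds 6 to n, raises the excess of the
    maxima by 3, lowers the minima by 3 and adds one forced row. The bounds on column plus [top_of]
    say that the symbols, shifted by [radius d], stay in the same gap as the columns. *)
Definition remainder_ok (d : remainder) : bool :=
  let w := radius d + radius d in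
  let I := iota 0 w in
  [&& 6 <= radius d,
      all (fun a => let s := start_of d a in
        [&& s <= a, a < s + block_size (kind_of d s), s + block_size (kind_of d s) <= w,
            (cell d a).2 < gap_size d (cell d a).1,
            radius d <= (cell d a).2 + top_of d a,
            (cell d a).2 + top_of d a < radius d + gap_size d (cell d a).1 &
            block_fits d s]) I,
      all (fun a => all (fun b =>
        [&& (start_of d a < start_of d b) ==>
              (start_of d a + block_size (kind_of d (start_of d a)) <= start_of d b),
            (cell d a == cell d b) ==> (a == b) &
            ((cell d a).1 == (cell d b).1) &&
              ((cell d a).2 + top_of d a == (cell d b).2 + top_of d b) ==> (a == b)]) I) I,
      sumn [seq top_of d a | a <- I] == sumn I + radius d,
      sumn [seq top_of d a | a <- I] < sumn [seq bot_of d a | a <- I] + w &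
      w %/ 6 <= count (fun a => forced_row (kind_of d (start_of d a)) (a - start_of d a)) I].

(** The block excesses 3 + 3 + 7, 3 + 2 + 2 + 7 and 3 + 3 + 7 + 2 equal the radii 13, 14 and 15. *)
Definition remainder26 : remainder :=
  Remainder 13 [:: (0, Triple false); (4, Triple false); (7, Quintuple)]
    [:: (false, 13); (true, 11); (false, 12); (false, 10); (true, 10); (true, 8);
        (true, 9); (false, 11); (false, 9); (false, 6); (false, 7); (false, 5);
        (true, 6); (false, 8); (true, 3); (true, 5); (true, 7); (true, 4); (true, 1);
        (false, 3); (true, 2); (false, 4); (false, 2); (false, 0); (true, 0);
        (false, 1)].

Definition remainder28 : remainder :=
  Remainder 14 [:: (0, Triple false); (3, Pair); (6, Pair); (9, Quintuple)]
    [:: (false, 14); (true, 12); (false, 13); (false, 9); (true, 11); (false, 12);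
        (false, 11); (true, 9); (false, 10); (true, 10); (true, 8); (true, 5);
        (true, 6); (true, 4); (false, 7); (true, 7); (false, 6); (false, 8);
        (false, 2); (false, 5); (false, 3); (true, 3); (true, 1); (true, 2);
        (false, 4); (false, 1); (true, 0); (false, 0)].

Definition remainder30 : remainder :=
  Remainder 15 [:: (0, Triple false); (4, Triple false); (7, Quintuple); (14, Pair)]
    [:: (false, 14); (true, 13); (false, 13); (false, 15); (true, 12); (true, 10);
        (true, 11); (false, 12); (false, 10); (false, 11); (false, 8); (false, 6);
        (true, 7); (true, 8); (true, 9); (false, 9); (true, 6); (true, 3); (false, 5);
        (true, 4); (false, 7); (true, 5); (false, 3); (true, 1); (false, 4); (true, 2);
        (false, 0); (false, 2); (true, 0); (false, 1)].

(** * Periodic rows and the full transversal *)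

Definition periodic_start (r : nat) : nat := if 0 < r %% 6 < 4 then r %/ 6 * 6 + 1 else r.

Definition periodic_kind (s : nat) : block_kind := if s %% 6 == 1 then Triple false else Single.

Definition gap_start (d : remainder) (q : nat) (g : bool) : nat :=
  if g then 6 * q + radius d + 1 else 3 * q.

Definition full_start (d : remainder) (q r : nat) : nat :=
  if r < 6 * q then periodic_start r else 6 * q + start_of d (r - 6 * q).

Definition full_kind (d : remainder) (q s : nat) : block_kind :=
  if s < 6 * q then periodic_kind s else kind_of d (s - 6 * q).

(** The residues 2, 4, 5 fill the columns below 3 q, and the residues 0, 1, 3 fill those from 3 q +
    radius + 1 to 6 q + radius; the two gaps are what remains. Per period the columns go down by 3
    and the rows up by 6, so the symbols go up by 3. *)
Definition full_col (d : remainder) (q r : nat) : nat :=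
  if r < 6 * q then
    match r %% 6 with
    | 0 => 6 * q + radius d - 3 * (r %/ 6)
    | 1 => 6 * q + radius d - 2 - 3 * (r %/ 6)
    | 2 => 3 * q - 2 - 3 * (r %/ 6)
    | 3 => 6 * q + radius d - 1 - 3 * (r %/ 6)
    | 4 => 3 * q - 1 - 3 * (r %/ 6)
    | _ => 3 * q - 3 - 3 * (r %/ 6)
    end
  else gap_start d q (cell d (r - 6 * q)).1 + (cell d (r - 6 * q)).2.

(* The symbol of the transversal in the row [r], shifted by [radius d] modulo [n]:
   with this shift the symbols run through the same intervals as the columns. *)
Definition full_sym (d : remainder) (q r : nat) : nat :=
  if r < 6 * q then
    match r %% 6 with
    | 0 => 3 * (r %/ 6)
    | 1 => 3 * (r %/ 6) + 1
    | 2 => 3 * q + radius d + 1 + 3 * (r %/ 6)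
    | 3 => 3 * (r %/ 6) + 2
    | 4 => 3 * q + radius d + 3 + 3 * (r %/ 6)
    | _ => 3 * q + radius d + 2 + 3 * (r %/ 6)
    end
  else gap_start d q (cell d (r - 6 * q)).1 +
    ((cell d (r - 6 * q)).2 + top_of d (r - 6 * q) - radius d).

(** A row that attains its maximum at y = 0; the anchor is put at its transversal cell. *)
Definition anchor_row (k : block_kind) : nat :=
  match k with Single => 0 | Pair => 2 | _ => 1 end.

Definition full_anchor (d : remainder) (q r : nat) : nat :=
  let s := full_start d q r in full_col d q (s + anchor_row (full_kind d q s)).

Definition orient (b : bool) (k : block_kind) : block_kind :=
  if k is Triple _ then Triple b else k.

(* Which of the outer rows of a triple is raised in the odd columns depends on
   the parity of [q], so the orientation is read off the transversal. *)
Definition full_block (d : remainder) (q r : nat) : block_kind :=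
  let s := full_start d q r in
  orient (~~ odd (full_col d q s + full_anchor d q r)) (full_kind d q s).

Lemma orientE (b : bool) (k : block_kind) :
  [/\ block_size (orient b k) = block_size k, top (orient b k) = top k,
      bot (orient b k) = bot k & forced_row (orient b k) = forced_row k].
Proof. by case: k. Qed.

Lemma sixP (r : nat) : exists j i, [/\ r = 6 * j + i, i < 6, r %/ 6 = j & r %% 6 = i].
Proof. by exists (r %/ 6), (r %% 6); split=> //; lia. Qed.

(** Conditions on the columns [u i] under which every row of the block attains its maximum, with the
    anchor at [u (anchor_row k)]. Wrapping around keeps the parity of y, as n is even; in a
    quintuple the bound [m] on the spread also keeps wrapped columns away from the exceptional
    positions. *)
Definition fits (k : block_kind) (u : nat -> nat) (m : nat) : Prop :=
  match k with
  | Single => True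
  | Triple _ | Pair => odd (u 0 + u 2)
  | Quintuple =>
    [/\ u 0 = u 1 + 2, u 3 + 2 = u 1, odd (u 2 + u 1) /\ u 2 + 1 <> u 1,
        u 4 + 1 = u 1 \/ ~~ odd (u 4 + u 1) /\ u 4 <> u 1 /\ u 4 + 2 <> u 1 &
        forall i, i < 5 -> u i <= u 1 + m /\ u 1 <= u i + m]
  end.

Lemma shifted_cases (n x c : nat) : x < n -> c < n ->
  shifted n x c + x = c \/ shifted n x c + x = c + n.
Proof.
move=> ltx ltc; have [lt|le] := leqP x c; [left|right].
  by rewrite (@shifted_eq n x c (c - x)) //; lia.
by rewrite (@shifted_eq n x c (c + n - x)) //; lia.
Qed.

Lemma offset_fits (n m i : nat) (k : block_kind) (u : nat -> nat) :
  ~~ odd n -> 8 <= n -> m + 3 <= n ->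
  (forall j, j < block_size k -> u j < n) ->
  (forall j l, j < block_size k -> l < block_size k -> u j = u l -> j = l) ->
  fits k u m -> i < block_size k ->
  offset n (orient (~~ odd (u 0 + u (anchor_row k))) k) i
    (shifted n (u (anchor_row k)) (u i)) = top k i.
Proof.
move=> even_n n_ge8 lem ltu uinj fit lti.
have ltx : u (anchor_row k) < n by apply: ltu; case: (k).
have n_gt0 : 0 < n by lia.
have := shifted_cases ltx (ltu _ lti); have := shifted_lt (u (anchor_row k)) (u i) n_gt0.
move: (shifted _ _ _) => y lty yE.
case: k fit lti yE ltu uinj {ltx} => [|b||] //= fit lti yE ltu uinj.
- have n0 := uinj 0 1 isT isT; have n2 := uinj 2 1 isT isT.
  have l0 := ltu 0 isT; have l1 := ltu 1 isT; have l2 := ltu 2 isT.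
  by case: i lti yE => [|[|[|i]]] //= _ yE; case: ifP => b1 /=; repeat (case: ifP => /= ?); lia.
- have l0 := ltu 0 isT; have l2 := ltu 2 isT.
  by case: i lti yE => [|[|[|i]]] //= _ yE; repeat (case: ifP => /= ?); lia.
- case: fit => f0 f3 [f2 f2'] f4 fm; have fi := fm i lti; have li := ltu i lti.
  have l1 := ltu 1 isT.
  by case: i lti yE fi li => [|[|[|[|[|i]]]]] //= _ yE fi li; repeat (case: ifP => /= ?); lia.
Qed.

Lemma eq_mod_or (n a b : nat) : a = b \/ a = b + n -> a = b %[mod n].
Proof. by case=> ->; rewrite ?modnDr. Qed.

(** The rows 6 j + 1, 6 j + 2, 6 j + 3 sum to 18 j + 6 and are replaced by three copies of 6 j + c.
    The maxima of a triple are the case c = 3, its minima the case c = 1. Adding 6 q on the left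
    avoids subtraction. *)
Lemma periodic_sum (q c : nat) :
  \sum_(r < 6 * q) (if 0 < r %% 6 < 4 then r %/ 6 * 6 + c else r) + 6 * q
    = \sum_(r < 6 * q) r + 3 * c * q.
Proof.
elim: q => [|q IHq]; first by rewrite !big_ord0 !muln0.
have -> : 6 * q.+1 = (6 * q).+4.+2 by lia.
rewrite !big_ord_recr /=; move: IHq.
have -> : (6 * q) %% 6 = 0 by lia.
have -> : (6 * q).+1 %% 6 = 1 by lia.
have -> : (6 * q).+2 %% 6 = 2 by lia.
have -> : (6 * q).+3 %% 6 = 3 by lia.
have -> : (6 * q).+4 %% 6 = 4 by lia.
have -> : (6 * q).+4.+1 %% 6 = 5 by lia.
move: (\sum_(i < 6 * q) _) (\sum_(i < 6 * q) _) => s t /=.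
by rewrite (mulnSr (3 * c)); lia.
Qed.

Lemma periodic_count (q : nat) :
  count (fun r => r %% 6 == 2) (iota 0 (6 * q)) = q.
Proof.
elim: q => [|q IHq] //.
rewrite (_ : 6 * q.+1 = 6 * q + 6) ?mulnSr // iotaD count_cat IHq /= add0n.
by repeat (case: eqP => /= ?); lia.
Qed.

(** * Extension of a remainder by q periods *)

Section Extension.

Variables (d : remainder) (q : nat).
Hypothesis ok : remainder_ok d.

Let w := radius d + radius d.
Let n := 6 * q + w.

Lemma radius_ge : 6 <= radius d.
Proof. by case/and3P: ok. Qed.

Lemma row_ok (a : nat) : a < w ->
  [/\ start_of d a <= a, a < start_of d a + block_size (kind_of d (start_of d a)),
      start_of d a + block_size (kind_of d (start_of d a)) <= w & block_fits d (start_of d a)].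
Proof.
case/and4P: ok => _ /allP okr _ _ lta.
by have /and5P[? ? ? ? /and3P[? ? ?]] := okr a (ltac:(by rewrite mem_iota)).
Qed.

Lemma cell_ok (a : nat) : a < w ->
  [/\ (cell d a).2 < gap_size d (cell d a).1, radius d <= (cell d a).2 + top_of d a &
      (cell d a).2 + top_of d a < radius d + gap_size d (cell d a).1].
Proof.
case/and4P: ok => _ /allP okr _ _ lta.
by have /and5P[? ? ? ? /and3P[? ? ?]] := okr a (ltac:(by rewrite mem_iota)).
Qed.

Lemma apart_ok (a b : nat) : a < w -> b < w -> start_of d a < start_of d b ->
  start_of d a + block_size (kind_of d (start_of d a)) <= start_of d b.
Proof.
case/and4P: ok => _ _ /allP okr _ lta ltb.
have /allP okr2 := okr a (ltac:(by rewrite mem_iota)).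
by have /and3P[/implyP] := okr2 b (ltac:(by rewrite mem_iota)).
Qed.

Lemma cell_inj (a b : nat) : a < w -> b < w -> cell d a = cell d b -> a = b.
Proof.
case/and4P: ok => _ _ /allP okr _ lta ltb e.
have /allP okr2 := okr a (ltac:(by rewrite mem_iota)).
have /and3P[_ /implyP + _] := okr2 b (ltac:(by rewrite mem_iota)).
by rewrite e eqxx => /(_ isT)/eqP.
Qed.

Lemma symbol_inj (a b : nat) : a < w -> b < w -> (cell d a).1 = (cell d b).1 ->
  (cell d a).2 + top_of d a = (cell d b).2 + top_of d b -> a = b.
Proof.
case/and4P: ok => _ _ /allP okr _ lta ltb e e'.
have /allP okr2 := okr a (ltac:(by rewrite mem_iota)).
have /and3P[_ _ /implyP] := okr2 b (ltac:(by rewrite mem_iota)).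
by rewrite e e' !eqxx => /(_ isT)/eqP.
Qed.

Lemma full_start_ok (r : nat) : r < n ->
  let s := full_start d q r in
  [/\ s <= r, r < s + block_size (full_kind d q s) & s + block_size (full_kind d q s) <= n].
Proof.
move=> ltr /=; rewrite /full_start /full_kind; case: ltnP => [lt6|ge6].
  have [j [i [rE lti _ rm]]] := sixP r.
  have -> : periodic_start r < 6 * q by rewrite /periodic_start; case: ifP; lia.
  have -> : periodic_kind (periodic_start r) = if 0 < i < 4 then Triple false else Single.
    rewrite /periodic_start rm; case: ifP => i4; rewrite /periodic_kind.
      by have -> : (r %/ 6 * 6 + 1) %% 6 == 1 by lia.
    by rewrite rm; case: eqP => // i1; lia.
  by rewrite /periodic_start rm; case: ifP => i4 /=; split; rewrite /n; lia.
rewrite (ltnNge (_ + _)) leq_addr /= addKn.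
by have [] := @row_ok (r - 6 * q); rewrite /n in ltr *; [lia|split; lia].
Qed.

Lemma full_start_split (r : nat) : (full_start d q r < 6 * q) = (r < 6 * q).
Proof.
rewrite /full_start; case: (ltnP r) => [lt6|ge6]; last by rewrite ltnNge leq_addr.
by rewrite /periodic_start; case: ifP; lia.
Qed.

Lemma full_apart (r s : nat) : r < n -> s < n -> full_start d q r < full_start d q s ->
  full_start d q r + block_size (full_kind d q (full_start d q r)) <= full_start d q s.
Proof.
move=> ltr lts; have [le1 lt1 le2] := full_start_ok ltr.
have [le3 lt3 le4] := full_start_ok lts.
have := full_start_split r; have := full_start_split s.
case: (ltnP r (6 * q)) => cr; case: (ltnP s (6 * q)) => cs cs' cr' lt.
- move: lt1 le2; rewrite /full_kind cr'.
  rewrite /full_start cr cs in lt *; rewrite /periodic_kind; case: eqP => /= m1; last by lia.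
  move: lt m1; rewrite /periodic_start; case: ifP => ?; case: ifP => ?; lia.
- rewrite /full_kind cr' /full_start cr /periodic_kind; case: ltnP; first by lia.
  move: (start_of _ _) => z _; rewrite /periodic_start.
  by case: ifP => ?; case: eqP => /= ?; lia.
- by lia.
- rewrite /full_kind cr' /full_start !ltnNge cr cs /= addKn in lt *.
  by rewrite -addnA leq_add2l; apply: apart_ok; rewrite /n in ltr lts; lia.
Qed.

Lemma full_col_lt (r : nat) : r < n -> full_col d q r < n.
Proof.
move=> ltr; rewrite /full_col; have hg := radius_ge; case: (ltnP r) => [lt6|ge6].
  have [j [i [rE lti -> ->]]] := sixP r.
  by case: i lti rE => [|[|[|[|[|[|i]]]]]] //= _ rE; rewrite /n /w; lia.
have [] := @cell_ok (r - 6 * q); first by rewrite /n in ltr; lia.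
by rewrite /gap_size /gap_start; case: (cell d _).1; rewrite /n /w; lia.
Qed.

Lemma full_sym_lt (r : nat) : r < n -> full_sym d q r < n.
Proof.
move=> ltr; rewrite /full_sym; have hg := radius_ge; case: (ltnP r) => [lt6|ge6].
  have [j [i [rE lti -> ->]]] := sixP r.
  by case: i lti rE => [|[|[|[|[|[|i]]]]]] //= _ rE; rewrite /n /w; lia.
have [] := @cell_ok (r - 6 * q); first by rewrite /n in ltr; lia.
by rewrite /gap_size /gap_start; case: (cell d _).1; rewrite /n /w; lia.
Qed.

Lemma full_col_inj : {in gtn n &, injective (full_col d q)}.
Proof.
move=> r s; rewrite !inE => ltr lts; rewrite /full_col; have hg := radius_ge.
case: (ltnP r) => cr; case: (ltnP s) => cs.
- have [j [i [rE lti -> ->]]] := sixP r; have [j' [i' [sE lti' -> ->]]] := sixP s.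
  by case: i lti rE => [|[|[|[|[|[|i]]]]]] //= _ rE;
     case: i' lti' sE => [|[|[|[|[|[|i']]]]]] //= _ sE; lia.
- have [j [i [rE lti -> ->]]] := sixP r.
  have [] := @cell_ok (s - 6 * q); first by rewrite /n in lts; lia.
  rewrite /gap_size /gap_start => c1 _ _.
  by case: i lti rE => [|[|[|[|[|[|i]]]]]] //= _ rE; case: (cell d _).1 c1; lia.
- have [j [i [sE lti -> ->]]] := sixP s.
  have [] := @cell_ok (r - 6 * q); first by rewrite /n in ltr; lia.
  rewrite /gap_size /gap_start => c1 _ _.
  by case: i lti sE => [|[|[|[|[|[|i]]]]]] //= _ sE; case: (cell d _).1 c1; lia.
- have lta : r - 6 * q < w by rewrite /n in ltr; lia.
  have ltb : s - 6 * q < w by rewrite /n in lts; lia.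
  have [c1 _ _] := cell_ok lta; have [c2 _ _] := cell_ok ltb => e.
  suff : r - 6 * q = s - 6 * q by lia.
  apply: cell_inj => //; move: c1 c2 e; rewrite /gap_size /gap_start.
  by case: (cell d _) => [[] c]; case: (cell d _) => [[] c'] /=;
    lia || (move=> *; congr pair; lia).
Qed.

Lemma full_sym_inj : {in gtn n &, injective (full_sym d q)}.
Proof.
move=> r s; rewrite !inE => ltr lts; rewrite /full_sym; have hg := radius_ge.
case: (ltnP r) => cr; case: (ltnP s) => cs.
- have [j [i [rE lti -> ->]]] := sixP r; have [j' [i' [sE lti' -> ->]]] := sixP s.
  by case: i lti rE => [|[|[|[|[|[|i]]]]]] //= _ rE;
     case: i' lti' sE => [|[|[|[|[|[|i']]]]]] //= _ sE; lia.
- have [j [i [rE lti -> ->]]] := sixP r.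
  have [] := @cell_ok (s - 6 * q); first by rewrite /n in lts; lia.
  rewrite /gap_size /gap_start => _ c1 c2.
  by case: i lti rE => [|[|[|[|[|[|i]]]]]] //= _ rE; case: (cell d _).1 c2; lia.
- have [j [i [sE lti -> ->]]] := sixP s.
  have [] := @cell_ok (r - 6 * q); first by rewrite /n in ltr; lia.
  rewrite /gap_size /gap_start => _ c1 c2.
  by case: i lti sE => [|[|[|[|[|[|i]]]]]] //= _ sE; case: (cell d _).1 c2; lia.
- have lta : r - 6 * q < w by rewrite /n in ltr; lia.
  have ltb : s - 6 * q < w by rewrite /n in lts; lia.
  have [_ c1 c2] := cell_ok lta; have [_ c3 c4] := cell_ok ltb => e.
  suff : r - 6 * q = s - 6 * q by lia.
  apply: symbol_inj => //; move: c1 c2 c3 c4 e; rewrite /gap_size /gap_start;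
  by case: (cell d (r - _)).1; case: (cell d (s - _)).1 => //=; lia.
Qed.

Lemma full_start_periodic (r : nat) : r < 6 * q ->
  [/\ full_start d q r = periodic_start r,
      full_kind d q (full_start d q r) = if 0 < r %% 6 < 4 then Triple false else Single &
      r - full_start d q r = if 0 < r %% 6 < 4 then (r %% 6).-1 else 0].
Proof.
move=> lt6; have lt6' := lt6; rewrite -full_start_split in lt6'.
rewrite /full_kind lt6' /full_start lt6 /periodic_kind /periodic_start.
by case: ifP => ?; split=> //; do ?case: eqP => ? //; lia.
Qed.

Lemma full_start_remainder (r : nat) : 6 * q <= r ->
  [/\ full_start d q r = 6 * q + start_of d (r - 6 * q),
      full_kind d q (full_start d q r) = kind_of d (start_of d (r - 6 * q)) &
      r - full_start d q r = r - 6 * q - start_of d (r - 6 * q)].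
Proof.
rewrite /full_start /full_kind leqNgt => /negbTE ->.
by rewrite (ltnNge (_ + _)) leq_addr /= addKn subnDA.
Qed.

(** The outer rows of a periodic triple have consecutive transversal columns, hence an odd sum. In
    the remainder, a quintuple has its cells in one gap of at most [radius d + 1] columns, which
    bounds the spread. *)
Lemma full_fits (r : nat) : r < n ->
  fits (full_kind d q (full_start d q r))
    (fun i => full_col d q (full_start d q r + i)) (radius d).
Proof.
move=> ltr; have [lt6|ge6] := ltnP r (6 * q).
  have [eqs -> _] := full_start_periodic lt6; have := full_start_split r; rewrite lt6 eqs.
  rewrite /periodic_start; case: ifP => //= r4 lts.
  have [j [i [rE lti rd rm]]] := sixP r; rewrite rd in lts *; rewrite rm in r4.
  have lt0 : j * 6 + 1 + 0 < 6 * q by lia.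
  have lt2 : j * 6 + 1 + 2 < 6 * q by lia.
  rewrite /full_col lt0 lt2.
  have [-> ->] : (j * 6 + 1 + 0) %% 6 = 1 /\ (j * 6 + 1 + 2) %% 6 = 3 by lia.
  have [-> ->] : (j * 6 + 1 + 0) %/ 6 = j /\ (j * 6 + 1 + 2) %/ 6 = j by lia.
  by have := radius_ge; lia.
have lta : r - 6 * q < w by rewrite /n in ltr; lia.
have [eqs -> _] := full_start_remainder ge6; rewrite eqs.
have [le1 lt1 le2 fit] := row_ok lta.
set s := start_of d _ in le1 lt1 le2 fit *.
have colE i : full_col d q (6 * q + s + i)
    = gap_start d q (cell d (s + i)).1 + (cell d (s + i)).2.
  by rewrite /full_col -addnA ltnNge leq_addr /= addKn.
have cellP i : i < block_size (kind_of d s) ->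
    (cell d (s + i)).2 < gap_size d (cell d (s + i)).1.
  by move=> lti; have [] := @cell_ok (s + i); first by lia.
move: fit cellP; rewrite /block_fits /fits; case: (kind_of d s) => [|b||] //=.
- by move=> /andP[/eqP e o] _; rewrite !colE e; lia.
- by move=> /andP[/eqP e o] _; rewrite !colE e; lia.
case/and5P=> /eqP e0 /eqP e2 /eqP e3 /eqP e4 /and5P[/eqP f0 /eqP f3 f2 /eqP f2' f4] cellP.
have c1 := cellP 1 isT.
rewrite !colE; split; rewrite ?e0 ?e2 ?e3 ?e4; try lia.
move=> i lti; have := cellP i lti; rewrite colE.
have -> : (cell d (s + i)).1 = (cell d (s + 1)).1.
  by case: i lti => [|[|[|[|[|i]]]]].
by move: c1; rewrite /gap_size; case: (cell d _).1; lia.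
Qed.

Lemma full_top (r : nat) :
  full_start d q r + top (full_kind d q (full_start d q r)) (r - full_start d q r)
    = if r < 6 * q then (if 0 < r %% 6 < 4 then r %/ 6 * 6 + 3 else r)
      else 6 * q + top_of d (r - 6 * q).
Proof.
case: (ltnP r) => [lt6|ge6].
  have [eqs -> _] := full_start_periodic lt6; rewrite eqs.
  by rewrite /periodic_start; case: ifP => ? /=; lia.
by have [eqs -> ->] := full_start_remainder ge6; rewrite eqs -addnA.
Qed.

Lemma full_bot (r : nat) :
  full_start d q r + bot (full_kind d q (full_start d q r)) (r - full_start d q r)
    = if r < 6 * q then (if 0 < r %% 6 < 4 then r %/ 6 * 6 + 1 else r)
      else 6 * q + bot_of d (r - 6 * q).
Proof.
case: (ltnP r) => [lt6|ge6].
  have [eqs -> _] := full_start_periodic lt6; rewrite eqs.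
  by rewrite /periodic_start; case: ifP => ? /=; lia.
by have [eqs -> ->] := full_start_remainder ge6; rewrite eqs -addnA.
Qed.

Lemma split_sum (c : nat) (f : nat -> nat) :
  \sum_(r < n) (if r < 6 * q then (if 0 < r %% 6 < 4 then r %/ 6 * 6 + c else r)
                else 6 * q + f (r - 6 * q)) + 6 * q + \sum_(a < w) a
    = \sum_(r < n) r + 3 * c * q + \sum_(a < w) f a.
Proof.
pose g r := if r < 6 * q then (if 0 < r %% 6 < 4 then r %/ 6 * 6 + c else r)
            else 6 * q + f (r - 6 * q).
have split_n (h : nat -> nat) :
    \sum_(r < n) h r = \sum_(r < 6 * q) h r + \sum_(a < w) h (6 * q + a).
  exact: big_split_ord.
have -> := split_n g; have /= -> := split_n id.
have -> : \sum_(r < 6 * q) g r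
    = \sum_(r < 6 * q) (if 0 < r %% 6 < 4 then r %/ 6 * 6 + c else r).
  by apply: eq_bigr => r _; rewrite /g ltn_ord.
have -> : \sum_(a < w) g (6 * q + a) = \sum_(a < w) (6 * q + f a).
  by apply: eq_bigr => a _; rewrite /g ltnNge leq_addr /= addKn.
have := periodic_sum q c; rewrite !big_split /=.
move: (\sum_(r < 6 * q) _) (\sum_(r < 6 * q) _) (\sum_(a < w) 6 * q) => s t v.
by move: (\sum_(a < w) f a) (\sum_(a < w) a) => s' t'; lia.
Qed.

Lemma forced_count :
  n %/ 6 <= count (fun r => forced_row (full_kind d q (full_start d q r))
    (r - full_start d q r)) (iota 0 n).
Proof.
case/and4P: ok => _ _ _ /and3P[_ _ cnt].
have -> : iota 0 n = iota 0 (6 * q) ++ [seq 6 * q + a | a <- iota 0 w].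
  by rewrite /n iotaD add0n -[in iota (6 * q)](addn0 (6 * q)) iotaDl.
rewrite count_cat count_map {1}/n.
have -> : (6 * q + w) %/ 6 = q + w %/ 6 by lia.
apply: leq_add; last first.
  apply: leq_trans cnt _; apply: eq_leq; apply: eq_count => a /=.
  by have [_ -> ->] := full_start_remainder (leq_addr a (6 * q)); rewrite addKn.
rewrite -{1}(periodic_count q); apply: eq_leq; apply: eq_in_count => r.
rewrite mem_iota => /andP[_ lt6]; have [_ -> ->] := full_start_periodic lt6.
by case: ifP => ? /=; lia.
Qed.

Lemma full_symE (r : nat) : r < n ->
  full_start d q r + top (full_kind d q (full_start d q r)) (r - full_start d q r)
    + full_col d q r + radius d = full_sym d q r %[mod n].
Proof.
move=> ltr; apply: eq_mod_or; rewrite full_top /full_col /full_sym; have hg := radius_ge.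
case: (ltnP r) => [lt6|ge6].
  have [j [i [rE lti -> ->]]] := sixP r.
  by case: i lti rE => [|[|[|[|[|[|i]]]]]] //= _ rE; rewrite /n /w; lia.
have [] := @cell_ok (r - 6 * q); first by rewrite /n in ltr; lia.
by rewrite /n /w; lia.
Qed.

Lemma full_blockE (r : nat) :
  let k := full_kind d q (full_start d q r) in
  [/\ block_size (full_block d q r) = block_size k, top (full_block d q r) = top k,
      bot (full_block d q r) = bot k & forced_row (full_block d q r) = forced_row k].
Proof. exact: orientE. Qed.

Lemma full_layout : layout n (full_start d q) (full_block d q) (full_anchor d q).
Proof.
split.
- move=> r ltr; have [le lt le'] := full_start_ok ltr; have [-> _ _ _] := full_blockE r.
  split=> //; apply: full_col_lt; apply: leq_trans le'; rewrite ltn_add2l.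
  by case: (full_kind _ _ _).
- by move=> r s _ _ e; rewrite /full_block /full_anchor e.
- by move=> r s ltr lts; have [-> _ _ _] := full_blockE r; apply: full_apart.
Qed.

Lemma full_tight (r : nat) : r < n ->
  offset n (full_block d q r) (r - full_start d q r)
    (shifted n (full_anchor d q r) (full_col d q r))
  = top (full_block d q r) (r - full_start d q r).
Proof.
move=> ltr; have hg := radius_ge; have [le lt le'] := full_start_ok ltr.
pose u i := full_col d q (full_start d q r + i).
have ltu j : j < block_size (full_kind d q (full_start d q r)) -> u j < n.
  by move=> ltj; apply: full_col_lt; lia.
have uinj j l : j < block_size (full_kind d q (full_start d q r)) ->
    l < block_size (full_kind d q (full_start d q r)) -> u j = u l -> j = l.
  move=> ltj ltl /full_col_inj e; apply/(@addnI (full_start d q r))/e; rewrite inE; lia.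
have even_n : ~~ odd n by rewrite /n /w; lia.
have n_ge8 : 8 <= n by rewrite /n /w; lia.
have lem : radius d + 3 <= n by rewrite /n /w; lia.
have lti : r - full_start d q r < block_size (full_kind d q (full_start d q r)) by lia.
have := offset_fits even_n n_ge8 lem ltu uinj (full_fits ltr) lti.
by have [_ -> _ _] := full_blockE r; rewrite /u addn0 subnKC.
Qed.

Lemma rigid_extension : rigid n.
Proof.
have hg := radius_ge.
case/and4P: ok => _ _ _ /and3P[/eqP sumT sumB _].
have /= eT := sum_ordE w (top_of d); have /= eB := sum_ordE w (bot_of d).
have /= eI := sum_ordE w id; rewrite map_id in eI.
rewrite -/w -eT -eI in sumT; rewrite -/w -eT -eB in sumB.
have topS := split_sum 3 (top_of d); have botS := split_sum 1 (bot_of d).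
have topE : \sum_(r < n) (full_start d q r + top (full_block d q r) (r - full_start d q r))
    = \sum_(r < n) (if r < 6 * q then (if 0 < r %% 6 < 4 then r %/ 6 * 6 + 3 else r)
      else 6 * q + top_of d (r - 6 * q)).
  by apply: eq_bigr => r _; rewrite -full_top; have [_ -> _ _] := full_blockE r.
have botE : \sum_(r < n) (full_start d q r + bot (full_block d q r) (r - full_start d q r))
    = \sum_(r < n) (if r < 6 * q then (if 0 < r %% 6 < 4 then r %/ 6 * 6 + 1 else r)
      else 6 * q + bot_of d (r - 6 * q)).
  by apply: eq_bigr => r _; rewrite -full_bot; have [_ _ -> _] := full_blockE r.
apply: (@rigid_of_layout n (radius d) (full_start d q) (full_block d q)
  (full_anchor d q) (full_col d q) (full_sym d q)) => //.
- by rewrite /n /w; lia.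
- by rewrite /n /w; lia.
- exact: full_layout.
- move=> r ltr; split; [exact: full_col_lt|exact: full_sym_lt|exact: full_tight|].
  by have [_ -> _ _] := full_blockE r; apply: full_symE.
- exact: full_col_inj.
- exact: full_sym_inj.
- move: topS; rewrite topE sumT {topE botE botS eT eB eI sumT sumB}.
  move: (\sum_(r < n) _) (\sum_(r < n) _) (\sum_(a < w) _) => s t v.
  by rewrite /n /w; lia.
- rewrite topE botE; move: topS botS sumT sumB {topE botE eT eB eI}.
  move: (\sum_(r < n) _) (\sum_(r < n) r) (\sum_(a < w) top_of d a) (\sum_(a < w) a).
  move: (\sum_(r < n) _) (\sum_(a < w) bot_of d a) => s1 s2 s3 s4 s5 s6.
  by rewrite /n /w; lia.
- apply: leq_trans forced_count _; apply: eq_leq; apply: eq_count => r.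
  by have [_ _ _ ->] := full_blockE r.
Qed.

End Extension.

(** * All even orders from 10 on *)

Theorem theorem6 (n : nat) :
  ~~ odd n -> 10 <= n ->
  exists L : 'I_n -> 'I_n -> 'I_n,
    latin_square L /\
    (exists T : {set 'I_n * 'I_n}, latin_transversal L T) /\
    (exists E : {set 'I_n * 'I_n},
        #|E| = n %/ 6 /\
        forall D : {set 'I_n * 'I_n}, suitable_diagonal L D -> E \subset D).
Proof.
move=> even_n n_ge10; change (rigid n).
have [lt26|ge26] := ltnP n 26; first by apply: rigid_small; rewrite ?n_ge10.
(* The remainder is the one of size congruent to n modulo 6. From n >= 26 it follows that n >= 30 in
   the first case and n >= 28 in the last, so the subtractions are exact. *)
have [e|[e|e]] : n %% 6 = 0 \/ n %% 6 = 2 \/ n %% 6 = 4 by lia.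
- have -> : n = 6 * ((n - 30) %/ 6) + (15 + 15) by lia.
  by apply: (@rigid_extension remainder30); vm_compute.
- have -> : n = 6 * ((n - 26) %/ 6) + (13 + 13) by lia.
  by apply: (@rigid_extension remainder26); vm_compute.
- have -> : n = 6 * ((n - 28) %/ 6) + (14 + 14) by lia.
  by apply: (@rigid_extension remainder28); vm_compute.
Qed.
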